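(* Let $d\ge1$ and let $Y_1,\dots,Y_d$ be identically distributed non-negative random variables. Let $a_i,\beta_i\ge0$ for $i=1,\dots,d$, and define $\hat S_d=a_1Y_1^{\beta_1}+a_2Y_2^{\beta_2}+\dots+a_dY_d^{\beta_d}$, $$\beta=\max_{1\le i\le d}\beta_i,\qquad q_d=\max_{\{1\le i\le d:\,\beta_i=\beta\}}a_i,\qquad J_d=\bigl|\{1\le i\le d:\beta_i=\beta,\ a_i=q_d\}\bigr|,$$ where $|\cdot|$ denotes the size of a set. Let $F$ be the distribution function of $q_dY_1^{\beta}$; assume $\sup\{x:F(x)<1\}=\infty$ and $F\in MDA(\Lambda)$ with an auxiliary function $f$ satisfying $f(x)\to\infty$ as $x\to\infty$. Assume further that (i) for all $1\le i\ne j\le d$ and all $t>0$, $\lim_{x\to\infty}P(q_dY_j^{\beta}>tf(x)\mid q_dY_i^{\beta}>x)=0$; (ii) for all $1\le i<j\le d$ there exists $L_{ij}>0$ such that $\lim_{x\to\infty}\dfrac{P(q_dY_j^{\beta}>L_{ij}f(x),\,q_dY_i^{\beta}>L_{ij}f(x))}{P(q_dY_i^{\beta}>x)}=0$. Then, as $x\to\infty$, $$P(\hat S_d>x)\sim J_d\,P\Bigl(Y_1^{\beta}>\frac{x}{q_d}\Bigr).$$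
   Context: $MDA(\Lambda)$ is the maximal domain of attraction of the Gumbel distribution $\Lambda(x)=\exp\{-e^{-x}\}$: the class of distribution functions $F$ for which there exist $\alpha_n>0$, $\gamma_n\in\mathbb{R}$ with $\lim_{n\to\infty}n\bar F(\alpha_nx+\gamma_n)=e^{-x}$ for all $x\in\mathbb{R}$, where $\bar F=1-F$. When $F$ has infinite right endpoint, $F\in MDA(\Lambda)$ is equivalent to the existence of an auxiliary function $f$: a positive function with derivative converging to $0$ at infinity, self-neglecting (i.e. $\lim_{t\to\infty}f(t+xf(t))/f(t)=1$ for all $x\in\mathbb{R}$), such that $\lim_{t\to\infty}\bar F(t+xf(t))/\bar F(t)=e^{-x}$ for all $x\in\mathbb{R}$. The function $f$ in the claim is such an auxiliary function of $F$. The notation $g(x)\sim h(x)$ means $g(x)/h(x)\to1$. *)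

(* Defs.v *)
From HB Require Import structures.
From mathcomp Require Import all_boot all_order all_algebra.
From mathcomp Require Import all_classical all_reals all_analysis.
From mathcomp Require Import measurable_realfun.

Set Implicit Arguments.
Unset Strict Implicit.
Unset Printing Implicit Defensive.
Import Order.TTheory GRing.Theory Num.Theory.
Import numFieldNormedType.Exports.
Local Open Scope classical_set_scope.
Local Open Scope ring_scope.

Section Gumbel.
Variable R : realType.
Implicit Types F f g h : R -> R.

Definition survival F : R -> R := fun x => 1 - F x.

Definition infinite_right_endpoint F : Prop :=
  ereal_sup [set x%:E | x in [set x | F x < 1]] = +oo%E.

Definition MDA_gumbel F : Prop :=
  exists alpha gamma : nat -> R, (forall n, 0 < alpha n) /\
    forall x, n%:R * survival F (alpha n * x + gamma n) @[n --> \oo] --> expR (- x).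

Definition self_neglecting f : Prop :=
  forall x, f (t + x * f t) / f t @[t --> +oo] --> (1 : R).

(* Only the behaviour of an auxiliary function near infinity matters (it need
   not even be defined elsewhere), hence positivity and differentiability are
   required only near infinity. *)
Definition auxiliary_function F f : Prop :=
  [/\ \forall x \near +oo, 0 < f x /\ derivable f x 1,
      derive1 f x @[x --> +oo] --> (0 : R),
      self_neglecting f &
      forall x, survival F (t + x * f t) / survival F t @[t --> +oo] --> expR (- x)].

Definition asymp_equiv g h : Prop := g x / h x @[x --> +oo] --> (1 : R).

End Gumbel.

Section Probability.
Context {disp : measure_display} {T : measurableType disp} {R : realType}.
Variable P : probability T R.

Definition prob (A : set T) : R := fine (P A).

Definition cond_prob (A B : set T) : R := prob (A `&` B) / prob B.

Definition identically_distributed (I : Type) (Y : I -> {RV P >-> R}) : Prop :=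
  forall (i j : I) (A : set R), measurable A ->
    distribution P (Y i) A = distribution P (Y j) A.

Definition real_cdf (X : {RV P >-> R}) : R -> R := fun x => fine (cdf X x).

Definition scaled_power (c b : R) (X : {RV P >-> R}) : T -> R :=
  fun w => c * X w `^ b.

Lemma measurable_scaled_power c b (X : {RV P >-> R}) :
  measurable_fun setT (scaled_power c b X).
Proof.
apply: measurable_funM; first exact: measurable_cst.
by apply: (measurableT_comp (measurable_powR _)).
Qed.

HB.instance Definition _ c b (X : {RV P >-> R}) :=
  isMeasurableFun.Build _ _ T R (scaled_power c b X)
    (measurable_scaled_power c b X).

End Probability.

Section Extremes.
Variables (R : realType) (d : nat).
Implicit Types a b : 'I_d -> R.

(* The default value 0 of the two maxima is harmless: they are used only for
   d >= 1 and nonnegative families. *)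
Definition max_exponent b : R := \big[Num.max/0]_(i < d) b i.

Definition max_coef a b : R :=
  \big[Num.max/0]_(i < d | b i == max_exponent b) a i.

Definition num_dominant a b : nat :=
  #|[set i : 'I_d | (b i == max_exponent b) && (a i == max_coef a b)]%SET|.

End Extremes.

(* Main.v *)
(* Write X_i = q Y_i^beta, with common tail G.  A term that is not dominant is at
   most c X_i + M with c < 1, and its tail is o(G) because f(x) = o(x) makes G
   rapidly varying.  If the sum exceeds x, then
   - some term exceeds x - eps f(x), which costs at most (J e^eps + o(1)) G(x), or
   - some X_i exceeds x - K f(x) and another X_j exceeds t f(x), which is o(G) by
     (i) applied at x - K f(x), or
   - two of the X_i exceed L f(x), which is o(G) by (ii).
   The lower bound is Bonferroni's inequality for the events {X_i > x}, i dominant,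
   with the pairs controlled by (i). *)
Require Import Defs.
From HB Require Import structures.
From mathcomp Require Import all_boot all_order all_algebra.
From mathcomp Require Import all_classical all_reals all_analysis.
From mathcomp Require Import measurable_realfun.
From mathcomp Require Import ring lra.

Set Implicit Arguments.
Unset Strict Implicit.
Unset Printing Implicit Defensive.
Import Order.TTheory GRing.Theory Num.Theory.
Import numFieldNormedType.Exports.
Local Open Scope classical_set_scope.
Local Open Scope ring_scope.

(** * Union bound and Bonferroni inequality for real-valued probabilities *)

Section Prob.
Context {disp : measure_display} {T : measurableType disp} {R : realType}.
Variable P : probability T R.

Lemma prob_ge0 (A : set T) : 0 <= prob P A.
Proof. exact/fine_ge0/measure_ge0. Qed.

Lemma EFin_prob (A : set T) : measurable A -> (prob P A)%:E = P A.
Proof. by move=> mA; rewrite /prob fineK// fin_num_measure. Qed.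

Lemma le_prob (A B : set T) : measurable A -> measurable B -> A `<=` B ->
  prob P A <= prob P B.
Proof.
by move=> mA mB AB; rewrite -lee_fin !EFin_prob// le_measure ?inE.
Qed.

Lemma probU (A B : set T) : measurable A -> measurable B ->
  prob P (A `|` B) = prob P A + prob P B - prob P (A `&` B).
Proof.
move=> mA mB; have mU := measurableU _ _ mA mB; have mI := measurableI _ _ mA mB.
apply: EFin_inj; rewrite EFinB EFinD !EFin_prob//.
by rewrite measureUfinr// ltey_eq fin_num_measure.
Qed.

Lemma prob_bigsetU_le (I : Type) (r : seq I) (Q : pred I) (A : I -> set T) :
  (forall i, measurable (A i)) ->
  prob P (\big[setU/set0]_(i <- r | Q i) A i) <= \sum_(i <- r | Q i) prob P (A i).
Proof.
move=> mA; elim: r => [|i r IH]; first by rewrite !big_nil /prob measure0.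
rewrite !big_cons; case: ifP => // Qi.
rewrite probU//; last exact: bigsetU_measurable.
by rewrite lerBlDr -addrA lerD2l (le_trans IH)// lerDl prob_ge0.
Qed.

(** Induction on [r]: adding [A i] loses only its overlap with the union of the later sets, which
    the union bound splits into pairs; [uniq r] guarantees that these pairs have [j != i]. The
    correction runs over all ordered pairs, coarser than the classical one but sufficient when every
    pair is negligible. *)
Lemma prob_Bonferroni (I : finType) (r : seq I) (Q : pred I) (A : I -> set T) :
  (forall i, measurable (A i)) -> uniq r ->
  \sum_(i <- r | Q i) prob P (A i) <=
  prob P (\big[setU/set0]_(i <- r | Q i) A i) +
  \sum_(i <- r | Q i) \sum_(j | j != i) prob P (A i `&` A j).
Proof.
move=> mA; elim: r => [|i r IH]; first by rewrite !big_nil addr0 prob_ge0.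
rewrite cons_uniq => /andP[ir ur]; rewrite !big_cons; case: ifP => [Qi|_]; last exact: IH.
have mU : measurable (\big[setU/set0]_(j <- r | Q j) A j) by exact: bigsetU_measurable.
rewrite probU//.
suff : prob P (A i `&` \big[setU/set0]_(j <- r | Q j) A j) <=
       \sum_(j | j != i) prob P (A i `&` A j) by have := IH ur; lra.
rewrite (big_distrr (A i))/=.
apply: le_trans (prob_bigsetU_le _ _ _) _.
  by move=> j; exact: measurableI.
rewrite big_mkcond/= big_uniq//= big_mkcond [leRHS]big_mkcond/=.
apply: ler_sum => j _; case: ifPn => jr; last by case: ifP => // _; exact: prob_ge0.
by rewrite (memPn ir)//; case: ifP => // _; exact: prob_ge0.
Qed.
End Prob.

(** * Sublinear growth of the auxiliary function *)

Section Growth.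
Context {R : realType}.

(** By the mean value theorem, once the slope is at most [e / 2], [f] stays below a line of slope
    [e / 2]; the other half of [e] absorbs the intercept. *)
Lemma derive1_cvg0_sublinear (f : R -> R) :
  (\forall x \near +oo, derivable f x 1) ->
  derive1 f x @[x --> +oo] --> (0 : R) ->
  forall e, 0 < e -> \forall x \near +oo, f x <= e * x.
Proof.
move=> fd f0 e e0.
have e20 : 0 < e / 2 by rewrite divr_gt0.
move/cvgrPdist_le : f0 => /(_ _ e20) f0.
have [A [Areal HA]] := filterI fd f0.
(* The eventual properties hold strictly beyond [A], while the mean value theorem needs continuity
   at the left endpoint too. *)
pose B := A + 1.
near=> x.
have Bx : B < x by near: x; apply: nbhs_pinfty_gt; exact: num_real.
have AB : A < B by rewrite /B ltrDl.
have [||c] := @MVT R f (derive1 f) B x Bx.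
- move=> y; rewrite in_itv/= => /andP[By _].
  have [+ _] := HA _ (lt_trans AB By).
  by move=> dy; rewrite derive1E; exact: DeriveDef.
- apply: derivable_within_continuous => y; rewrite in_itv/= => /andP[By _].
  by have [] := HA _ (lt_le_trans AB By).
rewrite in_itv/= => /andP[Bc cx] fxB.
have [_] := HA _ (lt_trans AB Bc).
rewrite sub0r normrN ler_norml => /andP[_ fc].
have : f x <= f B + e / 2 * (x - B).
  by rewrite -lerBlDl fxB ler_wpM2r// subr_ge0 ltW.
move/le_trans; apply.
have : 2 * (f B - e / 2 * B) / e <= x.
  by near: x; apply: nbhs_pinfty_ge; exact: num_real.
rewrite ler_pdivrMr//; lra.
Unshelve. all: by end_near. Qed.
End Growth.

(** * Deterministic case analysis of a large sum *)

Section Dichotomy.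
Context {R : realType} {d : nat}.
Implicit Types X Z : 'I_d -> R.

Lemma sum_one_big Z (i : 'I_d) (c : R) :
  (forall j, j != i -> Z j <= c) -> \sum_j Z j <= Z i + (d%:R * c - c).
Proof.
move=> Zc; rewrite (bigD1 i)//= lerD2l.
apply: (@le_trans _ _ (\sum_(j | j != i) c)); first exact: ler_sum.
have : \sum_(j < d) c = d%:R * c by rewrite sumr_const card_ord mulr_natl.
by rewrite (bigD1 i)//= => <-; rewrite addrC addrK.
Qed.

(** If no [X i] exceeds [L * F], the sum is at most [d%:R * (L + 1) * F], hence at most [x]. If
    exactly one does, the other terms are at most [(L + 1) * F] each, or at most [eps / d%:R * F]
    each when no other [X j] passes the small threshold; subtracting them leaves [Z i] close to [x].
    The factor 2 in that threshold makes room for [M]. *)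
Lemma sum_gt_cases X Z (M L eps F x : R) :
  (forall i, Z i <= X i + M) -> 0 < eps -> 0 < L -> 0 < F ->
  M <= eps / (2 * d%:R) * F -> M <= F -> d%:R * (L + 1) * F <= x ->
  x < \sum_i Z i ->
  [\/ exists i, x - eps * F < Z i,
      exists i j, [/\ i != j, x - d%:R * (L + 1) * F < X i
                    & eps / (2 * d%:R) * F < X j] |
      exists i j, [/\ i != j, L * F < X i & L * F < X j]].
Proof.
move=> ZX eps0 L0 F0 MeF MF xF xS.
have [|noi] := pselect (exists i, L * F < X i); last first.
  have : \sum_i Z i <= \sum_(i < d) (L + 1) * F.
    apply: ler_sum => i _; have := ZX i.
    have : X i <= L * F by rewrite leNgt; apply/negP => ?; apply: noi; exists i.
    lra.
  rewrite sumr_const card_ord -mulr_natl; lra.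
case=> i Xi.
have [[k [ik Xk]]|nok] := pselect (exists k, i != k /\ L * F < X k).
  by apply: Or33; exists i, k.
have d0 : 0 < d%:R :> R by rewrite ltr0n (leq_ltn_trans _ (ltn_ord i)).
have [[j [ij Xj]]|noj] := pselect (exists j, i != j /\ eps / (2 * d%:R) * F < X j).
  apply: Or32; exists i, j; split=> //.
  have := ZX i; suff : x - d%:R * (L + 1) * F + (L + 1) * F < Z i by nra.
  have : \sum_j Z j <= Z i + (d%:R * ((L + 1) * F) - (L + 1) * F).
    apply: sum_one_big => k ki; have := ZX k.
    have : X k <= L * F.
      by rewrite leNgt; apply/negP => ?; apply: nok; exists k; rewrite eq_sym.
    lra.
  lra.
apply: Or31; exists i.
have : \sum_j Z j <= Z i + (d%:R * (eps / d%:R * F) - eps / d%:R * F).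
  apply: sum_one_big => k ki; have := ZX k.
  have : X k <= eps / (2 * d%:R) * F.
    by rewrite leNgt; apply/negP => ?; apply: noj; exists k; rewrite eq_sym.
  have -> : eps / d%:R * F = eps / (2 * d%:R) * F + eps / (2 * d%:R) * F.
    by field; rewrite lt0r_neq0.
  lra.
have -> : d%:R * (eps / d%:R * F) = eps * F by field; rewrite lt0r_neq0.
have : 0 < eps / d%:R * F by rewrite mulr_gt0// divr_gt0.
lra.
Qed.
End Dichotomy.

(** * Rapid variation of the tail [G] and shifts by multiples of [f] *)

Section Tail.
Context {R : realType}.
Variables G f : R -> R.
Hypothesis G_gt0 : forall x, 0 < G x.
Hypothesis G_noninc : {homo G : x y /~ x <= y}.
Hypothesis f_gt0 : \forall x \near +oo, 0 < f x.
Hypothesis f_sublinear : forall e, 0 < e -> \forall x \near +oo, f x <= e * x.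
Hypothesis G_tail : forall u, G (x + u * f x) / G x @[x --> +oo] --> expR (- u).

Lemma negligible_le (h g : R -> R) :
  (\forall x \near +oo, 0 <= h x <= g x) ->
  g x / G x @[x --> +oo] --> (0 : R) -> h x / G x @[x --> +oo] --> (0 : R).
Proof.
move=> hg; apply: squeeze_cvgr (cvg_cst 0).
apply: filterS hg => x /andP[h0 hg].
by rewrite divr_ge0 ?(ltW (G_gt0 x))//= ler_pM2r ?invr_gt0.
Qed.

Lemma cvg_sub_auxiliary K : x - K * f x @[x --> +oo] --> +oo.
Proof.
(* With this slope [K * f x] is at most [x / 2], so the difference is at least [x / 2]; the added 1
   covers [K = 0]. *)
have e0 : 0 < (2 * (`|K| + 1))^-1 by rewrite invr_gt0 mulr_gt0// ltr_wpDl.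
have K0 : 0 <= K + `|K| by rewrite -lerBlDl sub0r -normrN ler_norm.
apply: (@ger_cvgy _ _ _ _ (fun x => x * 2^-1)); last exact: gt0_cvgMly.
near=> x.
have f0 : 0 < f x by near: x.
have : f x <= (2 * (`|K| + 1))^-1 * x by near: x; exact: f_sublinear.
rewrite mulrC ler_pdivlMr; last by rewrite mulr_gt0// ltr_wpDl.
have : K * f x <= `|K| * f x by rewrite ler_wpM2r ?ler_norm// ltW.
lra.
Unshelve. all: by end_near. Qed.

(** Dividing by [c < 1] gains a multiple of [x], which beats [K * f x] for every fixed [K]. The
    ratio is thus eventually at most [G (x + K * f x) / G x], whose limit [expR (- K)] is as small
    as desired. *)
Lemma tail_scaled_negligible (c M eps : R) : 0 < c -> c < 1 ->
  G ((x - eps * f x - M) / c) / G x @[x --> +oo] --> (0 : R).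
Proof.
move=> c0 c1; apply/cvgrPdist_le => e e0.
have /cvgrPdist_lt/(_ _ e0) := @cvgr_expR R.
move=> [K0 [_ /(_ (Num.max K0 0 + 1))]].
set K := Num.max K0 0 + 1.
have K_gt0 : 0 < K by rewrite ltr_wpDl// le_max lexx orbT.
have -> : K0 < K by rewrite ltr_pwDr// le_max lexx.
rewrite sub0r normrN => /(_ isT)/=; rewrite ger0_norm ?expR_ge0// => Ke.
have A0 : 0 < 2 * (K + `|eps| + 1).
  by rewrite mulr_gt0// ltr_wpDl// addr_ge0// ltW.
near=> x.
rewrite sub0r normrN ger0_norm; last by rewrite divr_ge0// ltW.
have f0 : 0 < f x by near: x.
(* Half of the gap [(1 - c) * x] pays for the multiples of [f x], the other half for [M]. *)
have fx : f x <= (1 - c) / (2 * (K + `|eps| + 1)) * x.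
  by near: x; apply: f_sublinear; rewrite divr_gt0// subr_gt0.
have xM : 2 * M / (1 - c) <= x.
  by near: x; apply: nbhs_pinfty_ge; exact: num_real.
apply: (@le_trans _ _ (G (x + K * f x) / G x)).
  rewrite ler_pM2r ?invr_gt0//; apply: G_noninc.
  rewrite ler_pdivlMr//.
  move: fx; rewrite mulrAC ler_pdivlMr// => fx.
  move: xM; rewrite ler_pdivrMr ?subr_gt0// => xM.
  have : eps * f x <= `|eps| * f x by rewrite ler_wpM2r ?ler_norm// ltW.
  have : K * f x * c <= K * f x.
    by rewrite ler_piMr ?mulr_ge0// ltW.
  lra.
apply/ltW; near: x.
exact: cvgr_lt (@G_tail K) _ Ke.
Unshelve. all: by end_near. Qed.

(** Factor through [G (x - K * f x)]: the first ratio tends to 0 along the shifted argument, the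
    second has the finite limit [expR K]. *)
Lemma negligible_sub_auxiliary (H : R -> R) (K : R) :
  H x / G x @[x --> +oo] --> (0 : R) ->
  H (x - K * f x) / G x @[x --> +oo] --> (0 : R).
Proof.
move=> HG.
have -> : (fun x => H (x - K * f x) / G x) =
    ((fun x => H x / G x) \o (fun x => x - K * f x)) \*
    (fun x => G (x + - K * f x) / G x).
  by apply/funext => x /=; rewrite mulNr mulrA divfK// lt0r_neq0.
rewrite -(mul0r (expR (- - K))); apply: cvgM; last exact: G_tail.
exact: cvg_comp (cvg_sub_auxiliary K) HG.
Qed.
End Tail.

(** * Tail asymptotics of the sum, from abstract domination hypotheses *)

Section Core.
Context {disp : measure_display} {T : measurableType disp} {R : realType}.
Context (P : probability T R) (d : nat).
Hypothesis d_gt0 : (0 < d)%N.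
Variables (X Z : 'I_d -> T -> R) (D : pred 'I_d) (G f : R -> R).
Hypothesis mX : forall i, measurable_fun setT (X i).
Hypothesis mZ : forall i, measurable_fun setT (Z i).
Hypothesis Z_ge0 : forall i w, 0 <= Z i w.
Hypothesis Z_dom : forall i, D i -> Z i = X i.
Hypothesis Z_nondom : forall i, ~~ D i -> exists c M, [/\ 0 < c, c < 1 &
  forall w, Z i w <= c * X i w + M].
Hypothesis X_ge0 : forall i w, 0 <= X i w.
Hypothesis X_tail : forall i x, prob P [set w | x < X i w] = G x.
Hypothesis G_gt0 : forall x, 0 < G x.
Hypothesis f_cvgy : f x @[x --> +oo] --> +oo.
Hypothesis f_sublinear : forall e, 0 < e -> \forall x \near +oo, f x <= e * x.
Hypothesis f_sn : self_neglecting f.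
Hypothesis G_tail : forall u, G (x + u * f x) / G x @[x --> +oo] --> expR (- u).
Hypothesis joint_small : forall i j, i != j -> forall t, 0 < t ->
  prob P [set w | t * f x < X j w /\ x < X i w] / G x @[x --> +oo] --> (0 : R).
Hypothesis joint_large : forall i j, i != j -> exists L, 0 < L /\
  prob P [set w | L * f x < X j w /\ L * f x < X i w] / G x
    @[x --> +oo] --> (0 : R).

Let f_gt0 : \forall x \near +oo, 0 < f x.
Proof. exact: cvgry_gt. Qed.

Lemma measurable_gt (g : T -> R) x : measurable_fun setT g ->
  measurable [set w | x < g w].
Proof.
move=> mg; rewrite -[X in measurable X]setTI.
have -> : [set w | x < g w] = g @^-1` `]x, +oo[.
  by apply/seteqP; split=> w /=; rewrite in_itv/= andbT.
exact: mg.
Qed.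

Lemma measurable_gt2 (g h : T -> R) x y :
  measurable_fun setT g -> measurable_fun setT h ->
  measurable [set w | x < g w /\ y < h w].
Proof. by move=> mg mh; apply: measurableI; exact: measurable_gt. Qed.

Lemma tail_noninc (i0 : 'I_d) : {homo G : x y /~ x <= y}.
Proof.
move=> x y xy; rewrite -!(X_tail i0); apply: le_prob; try exact: measurable_gt.
by move=> w /=; apply: le_lt_trans.
Qed.

(** Raising the threshold shrinks the joint event, so one [L] above all the pairwise constants
    serves every pair. *)
Lemma uniform_joint_large : exists L, 0 < L /\ forall i j, i != j ->
  prob P [set w | L * f x < X i w /\ L * f x < X j w] / G x
    @[x --> +oo] --> (0 : R).
Proof.
have /choice[L0 HL0] : forall p : 'I_d * 'I_d, exists L, 0 < L /\ (p.1 != p.2 ->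
    prob P [set w | L * f x < X p.1 w /\ L * f x < X p.2 w] / G x
    @[x --> +oo] --> (0 : R)).
  (* The diagonal carries no constraint; 1 is a dummy that lets the choice range over all pairs. *)
  case=> i j /=; case: (eqVneq i j) => [_|ij]; first by exists 1.
  rewrite eq_sym in ij.
  by have [L [L_gt0 HL]] := joint_large ij; exists L.
exists (1 + \sum_p L0 p); split.
  by rewrite ltr_pwDl// sumr_ge0// => p _; rewrite ltW// (HL0 p).1.
move=> i j ij; have [L_gt0 /(_ ij) HL] := HL0 (i, j).
apply: (negligible_le G_gt0 _ HL); near=> x.
have fx : 0 < f x by near: x.
rewrite prob_ge0/=.
apply: le_prob; try exact: measurable_gt2.
have LL : L0 (i, j) * f x <= (1 + \sum_p L0 p) * f x.
  rewrite ler_pM2r// (bigD1 (i, j))//= addrCA lerDl addr_ge0// sumr_ge0// => p _.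
  by rewrite ltW// (HL0 p).1.
by move=> w /= [w1 w2]; split; [exact: le_lt_trans w1|exact: le_lt_trans w2].
Unshelve. all: by end_near. Qed.

(** [joint_small] is applied at [x - K * f x] with [t / 2]. Self-neglect bounds [f] at the shifted
    point by [2 * f x], so the threshold there is at most [t * f x]. *)
Lemma joint_shifted_negligible (i j : 'I_d) (K t : R) : i != j -> 0 < t ->
  prob P [set w | x - K * f x < X i w /\ t * f x < X j w] / G x
    @[x --> +oo] --> (0 : R).
Proof.
move=> ij t0.
have t20 : 0 < t / 2 by rewrite divr_gt0.
have := negligible_sub_auxiliary G_gt0 f_gt0 f_sublinear G_tail K (joint_small ij t20).
move=> H; apply: (negligible_le G_gt0 _ H).
have sn := cvgr_le _ (f_sn (- K)) _ (ltr1n R 2).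
near=> x.
have fx : 0 < f x by near: x.
rewrite prob_ge0/=.
apply: le_prob; try exact: measurable_gt2.
move=> w /= [w1 w2]; split=> //; apply: le_lt_trans w2.
have : f (x + - K * f x) / f x <= 2 by near: x; exact: sn.
rewrite mulNr ler_pdivrMr//; nra.
Unshelve. all: by end_near. Qed.

Lemma nondominant_negligible i eps : ~~ D i ->
  prob P [set w | x - eps * f x < Z i w] / G x @[x --> +oo] --> (0 : R).
Proof.
move=> /Z_nondom[c [M [c0 c1 ZM]]].
have H := tail_scaled_negligible G_gt0 (tail_noninc i) f_gt0 f_sublinear G_tail M eps c0 c1.
apply: (negligible_le G_gt0 _ H); near=> x.
rewrite prob_ge0/= -(X_tail i).
apply: le_prob; try exact: measurable_gt.
move=> w /= w1; rewrite ltr_pdivrMr//; have := ZM w; lra.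
Unshelve. all: by end_near. Qed.

Lemma nondominant_bound : exists M, forall i w, Z i w <= X i w + M.
Proof.
have /choice[M HM] : forall i, exists M, 0 <= M /\ forall w, Z i w <= X i w + M.
  move=> i; case: (boolP (D i)) => [/Z_dom ->|/Z_nondom[c [M [c0 c1 ZM]]]].
    by exists 0; split=> // w; rewrite addr0.
  exists `|M|; split=> // w; have := ZM w; have := ler_norm M; have := X_ge0 i w.
  by nra.
exists (\sum_i M i) => i w; apply: le_trans ((HM i).2 w) _.
rewrite lerD2l (bigD1 i)//= lerDl sumr_ge0// => j _; exact: (HM j).1.
Qed.

Lemma measurable_sumZ : measurable_fun setT (fun w => \sum_i Z i w).
Proof. exact: measurable_sum. Qed.

(** As the terms are nonnegative, a single dominant [X i] above [x] already puts the sum above [x];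
    Bonferroni then applies to these events. *)
Lemma dominant_lower_bound x :
  #|D|%:R * G x - \sum_(i | D i) \sum_(j | j != i) 
    prob P [set w | x < X i w /\ x < X j w]
  <= prob P [set w | x < \sum_i Z i w].
Proof.
have mA i : measurable [set w | x < X i w] by exact: measurable_gt.
have := prob_Bonferroni P D mA (index_enum_uniq _).
rewrite (eq_bigr (fun=> G x)); last by move=> i _; exact: X_tail.
rewrite (eq_bigl (mem D))// sumr_const => H.
rewrite lerBlDr mulr_natl; apply: le_trans H _; rewrite lerD2r.
apply: le_prob.
- exact: bigsetU_measurable.
- exact: measurable_gt measurable_sumZ.
- elim/big_ind: _ => // [A B hA hB w [/hA|/hB]//|i Di w /=].
  rewrite -(Z_dom Di) => /lt_le_trans; apply.
  by rewrite (bigD1 i)//= lerDl sumr_ge0.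
Qed.

Lemma sum_tail_le (eps L x : R) (K := d%:R * (L + 1)) (t := eps / (2 * d%:R))
    (M : R) :
  (forall i w, Z i w <= X i w + M) -> 0 < eps -> 0 < L -> 0 < f x ->
  M <= t * f x -> M <= f x -> K * f x <= x ->
  prob P [set w | x < \sum_i Z i w] <=
  \sum_i prob P [set w | x - eps * f x < Z i w] +
  (\sum_(p : 'I_d * 'I_d | p.1 != p.2)
     prob P [set w | x - K * f x < X p.1 w /\ t * f x < X p.2 w] +
   \sum_(p : 'I_d * 'I_d | p.1 != p.2)
     prob P [set w | L * f x < X p.1 w /\ L * f x < X p.2 w]).
Proof.
move=> ZX eps0 L0 fx MtF MF KF.
have mA i : measurable [set w | x - eps * f x < Z i w] by exact: measurable_gt.
have mB (p : 'I_d * 'I_d) :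
    measurable [set w | x - K * f x < X p.1 w /\ t * f x < X p.2 w].
  exact: measurable_gt2.
have mC (p : 'I_d * 'I_d) :
    measurable [set w | L * f x < X p.1 w /\ L * f x < X p.2 w].
  exact: measurable_gt2.
apply: le_trans (lerD (prob_bigsetU_le P _ _ mA)
  (lerD (prob_bigsetU_le P _ _ mB) (prob_bigsetU_le P _ _ mC))).
rewrite -!bigcup_pred.
set A := \bigcup_(_ in _) _; set B := \bigcup_(_ in _) _.
set C := \bigcup_(_ in _) _.
have mA' : measurable A by exact: fin_bigcup_measurable.
have mB' : measurable B by exact: fin_bigcup_measurable.
have mC' : measurable C by exact: fin_bigcup_measurable.
have mBC := measurableU _ _ mB' mC'.
apply: (@le_trans _ _ (prob P (A `|` (B `|` C)))).
  apply: le_prob; [exact: measurable_gt measurable_sumZ|exact: measurableU|].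
  move=> w /= Sw.
  have := sum_gt_cases (fun i => ZX i w) eps0 L0 fx MtF MF KF Sw.
  case=> [[i Zi]|[i [j [ij Xi Xj]]]|[i [j [ij Xi Xj]]]].
  - by left; exists i.
  - by right; left; exists (i, j).
  - by right; right; exists (i, j).
rewrite probU//; have := probU P mB' mC'.
have := prob_ge0 P (A `&` (B `|` C)); have := prob_ge0 P (B `&` C).
lra.
Qed.

Lemma sum_tail_equiv :
  prob P [set w | x < \sum_i Z i w] / G x @[x --> +oo] --> (#|D|%:R : R).
Proof.
apply/cvgrPdist_le => e e0.
have [M ZX] := nondominant_bound.
have [L [L0 HL]] := uniform_joint_large.
(* Continuity of [expR] at 0 makes the cost of lowering the level by [eps * f x] less than [e]. *)
have [eps eps0 Heps] : exists2 eps : R, 0 < eps & #|D|%:R * expR eps < #|D|%:R + e.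
  have : #|D|%:R * expR u @[u --> (0:R)^'+] --> #|D|%:R * expR 0.
    apply: cvgM; first exact: cvg_cst.
    apply: cvg_at_right_filter; exact: continuous_expR.
  rewrite expR0 mulr1 => /cvgr_lt /(_ (#|D|%:R + e)); rewrite ltrDl => /(_ e0) H.
  near (0:R)^'+ => u; exists u; first by near: u; exact: nbhs_right_gt.
  by near: u.
pose K := d%:R * (L + 1); pose t := eps / (2 * d%:R).
have t0 : 0 < t by rewrite divr_gt0// mulr_gt0// ltr0n.
have K0 : 0 < K by rewrite mulr_gt0 ?ltr0n// addr_gt0.
pose U x := \sum_i prob P [set w | x - eps * f x < Z i w] / G x +
  (\sum_(p : 'I_d * 'I_d | p.1 != p.2)
     prob P [set w | x - K * f x < X p.1 w /\ t * f x < X p.2 w] / G x +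
   \sum_(p : 'I_d * 'I_d | p.1 != p.2)
     prob P [set w | L * f x < X p.1 w /\ L * f x < X p.2 w] / G x).
(* Each dominant term contributes [expR eps]; nondominant terms and both pair sums vanish. *)
have cU : U x @[x --> +oo] --> #|D|%:R * expR eps.
  have -> : #|D|%:R * expR eps = \sum_i (if D i then expR eps else 0) +
    (\sum_(p : 'I_d * 'I_d | p.1 != p.2) 0 +
     \sum_(p : 'I_d * 'I_d | p.1 != p.2) 0).
    by rewrite !big1_eq !addr0 -big_mkcond/= (eq_bigl (mem D))// sumr_const mulr_natl.
  apply: cvgD; last apply: cvgD.
  - apply: cvg_big => [|i _]; first exact: add_continuous.
    case: (boolP (D i)) => [Di|nDi]; last exact: nondominant_negligible.
    under eq_cvg do rewrite (Z_dom Di) X_tail -mulNr.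
    by have := @G_tail (- eps); rewrite opprK.
  - apply: cvg_big => [|p pp]; first exact: add_continuous.
    exact: joint_shifted_negligible.
  - apply: cvg_big => [|p pp]; first exact: add_continuous.
    exact: HL.
pose V x := #|D|%:R - \sum_(i | D i) \sum_(j | j != i)
    prob P [set w | x < X i w /\ x < X j w] / G x.
have cV : V x @[x --> +oo] --> (#|D|%:R : R).
  have : V x @[x --> +oo] -->
      (#|D|%:R - \sum_(i | D i) \sum_(j < d | j != i) 0 : R).
    apply: cvgB; first exact: cvg_cst.
    apply: cvg_big => [|i Di]; first exact: add_continuous.
    apply: cvg_big => [|j ij]; first exact: add_continuous.
    rewrite eq_sym in ij.
    (* Since [f x <= x] eventually, exceeding [x] implies exceeding [1 * f x], so [joint_small] with
       [t = 1] suffices. *)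
    apply: (negligible_le G_gt0 _ (joint_small ij ltr01)); near=> x.
    rewrite prob_ge0/=; apply: le_prob; try exact: measurable_gt2.
    move=> w /= [w1 w2]; split => //; apply: le_lt_trans w2.
    by rewrite mul1r -[leRHS]mul1r; near: x; exact: f_sublinear.
  by under eq_bigr do rewrite big1_eq; rewrite big1_eq subr0.
have nV : \forall x \near +oo, #|D|%:R - e <= V x.
  by apply: (cvgr_ge _ cV); rewrite ltrBlDr ltrDl.
have nU : \forall x \near +oo, U x <= #|D|%:R + e by exact: (cvgr_le _ cU).
(* Divergence of [f] absorbs the additive constant [M] at both scales required by [sum_tail_le]. *)
have fM : \forall x \near +oo, M <= f x by exact: cvgry_ge.
have f1 : \forall x \near +oo, M / t <= f x by exact: cvgry_ge.
near=> x.
have fx : 0 < f x by near: x.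
have Gx := G_gt0 x.
have hV : #|D|%:R - e <= V x by near: x.
have hU : U x <= #|D|%:R + e by near: x.
rewrite distrC ler_norml; apply/andP; split.
  rewrite lerBrDl.
  apply: le_trans hV _; rewrite ler_pdivlMr//.
  apply: le_trans (dominant_lower_bound x); rewrite /V mulrBl lerD2l lerN2.
  rewrite mulr_suml; apply: ler_sum => i _.
  rewrite mulr_suml; apply: ler_sum => j _.
  by rewrite divfK// gt_eqF.
rewrite lerBlDl; apply: le_trans hU; rewrite ler_pdivrMr//.
rewrite /U !mulrDl !mulr_suml.
under eq_bigr do rewrite divfK ?gt_eqF//.
under [X in _ + (X + _)]eq_bigr do rewrite divfK ?gt_eqF//.
under [X in _ + (_ + X)]eq_bigr do rewrite divfK ?gt_eqF//.
apply: sum_tail_le ZX _ _ _ _ _ _ => //.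
- by rewrite -ler_pdivrMl// mulrC; near: x.
- by near: x.
- by rewrite -ler_pdivlMl//; near: x; apply: f_sublinear; rewrite invr_gt0.
Unshelve. all: by end_near. Qed.
End Core.

(** * Comparison of nondominant powers with the dominant one *)

Section Dominance.
Context {R : realType}.

Lemma powR_lower_order (a q s t : R) : 0 <= a -> 0 < q -> 0 <= s -> s < t ->
  exists M, forall y, 0 <= y -> a * y `^ s <= q * y `^ t + M.
Proof.
move=> a0 q0 s0 st; have ts0 : 0 < t - s by rewrite subr_gt0.
(* The crossover point: beyond it [q * y ^ t] dominates [a * y ^ s], and below it the constant
   [a * y0 ^ s] does. *)
pose y0 := (a / q) `^ (t - s)^-1.
exists (a * y0 `^ s) => y y_ge0.
have [yy0|y0y] := leP y y0.
  have : a * y `^ s <= a * y0 `^ s.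
    by rewrite ler_wpM2l// ge0_ler_powR// nnegrE// powR_ge0.
  have : 0 <= q * y `^ t by rewrite mulr_ge0 ?powR_ge0// ltW.
  lra.
have y_gt0 : 0 < y by exact: le_lt_trans (powR_ge0 _ _) y0y.
have aq : a / q <= y `^ (t - s).
  rewrite -[leLHS]powRr1; last by rewrite divr_ge0// ltW.
  rewrite -(@mulVf _ (t - s)) ?gt_eqF// powRrM.
  by apply: ge0_ler_powR; rewrite ?nnegrE ?powR_ge0 ?ltW.
have -> : t = s + (t - s) by ring.
rewrite powRD; last by rewrite (gt_eqF y_gt0) implybT.
move: aq; rewrite ler_pdivrMr// => aq.
have : a * y `^ s <= y `^ (t - s) * q * y `^ s by rewrite ler_wpM2r ?powR_ge0.
have : 0 <= a * y0 `^ s by rewrite mulr_ge0 ?powR_ge0.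
lra.
Qed.

Lemma bigmax_attained (I : finType) (Q : pred I) (g : I -> R) (i0 : I) :
  Q i0 -> (forall i, 0 <= g i) ->
  exists2 i, Q i & \big[Num.max/0]_(i | Q i) g i = g i.
Proof.
move=> Qi0 g0; rewrite (bigmax_eq_arg _ i0)//.
by case: arg_maxP => // i Qi _; exists i.
Qed.

Variables (d : nat) (a b : 'I_d -> R).
Hypothesis (a_ge0 : forall i, 0 <= a i) (b_ge0 : forall i, 0 <= b i).

Lemma max_exponent_ge i : b i <= max_exponent b.
Proof. exact: le_bigmax. Qed.

Lemma max_coef_ge i : b i = max_exponent b -> a i <= max_coef a b.
Proof. by move=> bi; apply: le_bigmax_cond; apply/eqP. Qed.

Lemma num_dominant_gt0 : (0 < d)%N -> (0 < num_dominant a b)%N.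
Proof.
move=> d0; have [i _ Ei] := bigmax_attained (i0 := Ordinal d0) (Q := xpredT) isT b_ge0.
have bi : b i == max_exponent b by rewrite eq_sym; apply/eqP.
have [j bj Ej] := bigmax_attained (Q := fun j => b j == max_exponent b) bi a_ge0.
by apply/card_gt0P; exists j; rewrite inE bj /max_coef Ej eqxx.
Qed.

Lemma nondominant_le i : 0 < max_coef a b ->
  ~~ ((b i == max_exponent b) && (a i == max_coef a b)) ->
  exists c M, [/\ 0 < c, c < 1 & forall y, 0 <= y ->
    a i * y `^ b i <= c * (max_coef a b * y `^ max_exponent b) + M].
Proof.
set q := max_coef a b; set beta := max_exponent b => q0 nD.
have [bi|bi] := eqVneq (b i) beta.
  rewrite bi eqxx/= neq_lt orbC ltNge max_coef_ge//= -/q in nD.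
  (* The midpoint of [a i / q] and 1 is below 1 and stays positive even when [a i = 0]. *)
  exists ((a i / q + 1) / 2), 0.
  have aq1 : a i / q < 1 by rewrite ltr_pdivrMr// mul1r.
  have aq0 : 0 <= a i / q by rewrite divr_ge0// ltW.
  split; [lra|lra|move=> y y0; rewrite addr0 bi mulrA ler_wpM2r ?powR_ge0//].
  have -> : (a i / q + 1) / 2 * q = (a i + q) / 2 by field; rewrite gt_eqF.
  lra.
have bi' : b i < beta by rewrite lt_neqAle bi max_exponent_ge.
have q20 : 0 < q / 2 by rewrite divr_gt0.
(* With a strictly smaller exponent any positive coefficient would dominate; [q / 2] yields
   [c = 1 / 2]. *)
have [M HM] := powR_lower_order (a_ge0 i) q20 (b_ge0 i) bi'.
exists 2^-1, M; split; [lra|lra|move=> y /HM]; lra.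
Qed.
End Dominance.

(** * Tails of scaled powers of random variables *)

Section ScaledPower.
Context {disp : measure_display} {T : measurableType disp} {R : realType}.
Variable P : probability T R.
Implicit Type X : {RV P >-> R}.

Lemma survival_real_cdf X x : survival (real_cdf X) x = prob P [set w | x < X w].
Proof.
have -> : prob P [set w | x < X w] = fine (ccdf X x).
  rewrite /prob /ccdf /distribution /pushforward; congr (fine (P _)).
  by apply/seteqP; split=> w /=; rewrite in_itv/= andbT.
have := congr1 fine (cdf_ccdf_1 X x).
rewrite fineD/=; first by rewrite /survival /real_cdf => <-; rewrite addrC addKr.
  exact: fin_num_measure.
exact: fin_num_measure.
Qed.

Lemma infinite_right_endpoint_prob_gt0 X : infinite_right_endpoint (real_cdf X) ->
  forall x, 0 < prob P [set w | x < X w].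
Proof.
move=> Xinfty x; have : (x%:E < +oo)%E by rewrite ltry.
rewrite -Xinfty => /ereal_sup_gt[_ [y /= Fy <-]]; rewrite lte_fin => xy.
have : 0 < survival (real_cdf X) y by rewrite subr_gt0.
rewrite survival_real_cdf => /lt_le_trans; apply.
apply: le_prob; try exact: measurable_gt.
by move=> w /=; apply: lt_trans.
Qed.

(** With [c = 0] the variable would vanish identically and have no mass above 0. This gives [0 < q]
    in the theorem. *)
Lemma infinite_right_endpoint_scaled_power X c s : 0 <= c ->
  infinite_right_endpoint (real_cdf (P := P) (scaled_power c s X)) -> 0 < c.
Proof.
move=> c0 /infinite_right_endpoint_prob_gt0/(_ 0) pos.
rewrite lt_neqAle c0 andbT eq_sym; move: pos.
apply: contraTN => /eqP ->.
suff -> : [set w | 0 < scaled_power 0 s X w] = set0 by rewrite /prob measure0 ltxx.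
by rewrite -subset0 => w /=; rewrite /scaled_power mul0r ltxx.
Qed.

Lemma identically_distributed_scaled_power (I : Type) (Y : I -> {RV P >-> R}) c s :
  identically_distributed Y -> forall i j x,
  prob P [set w | x < scaled_power c s (Y i) w] =
  prob P [set w | x < scaled_power c s (Y j) w].
Proof.
move=> Y_id i j x.
have mB : measurable [set y : R | x < c * y `^ s].
  apply: measurable_gt; apply: measurable_funM; first exact: measurable_cst.
  exact: measurable_powR.
congr fine; exact: Y_id mB.
Qed.
End ScaledPower.

Theorem theorem4p5 (R : realType) (disp : measure_display)
    (T : measurableType disp) (P : probability T R)
    (d : nat) (d_ge1 : (0 < d)%N)
    (Y : 'I_d -> {RV P >-> R})
    (Y_id : identically_distributed Y)
    (Y_ge0 : forall i w, 0 <= Y i w)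
    (a b : 'I_d -> R)
    (a_ge0 : forall i, 0 <= a i) (b_ge0 : forall i, 0 <= b i)
    (f : R -> R) :
  let beta := max_exponent b in
  let q := max_coef a b in
  let J := num_dominant a b in
  let Y1 := Y (Ordinal d_ge1) in
  let F := real_cdf (P := P) (scaled_power q beta Y1) in
  infinite_right_endpoint F ->
  MDA_gumbel F ->
  auxiliary_function F f ->
  f x @[x --> +oo] --> +oo ->
  (forall i j : 'I_d, i != j -> forall t : R, 0 < t ->
     cond_prob P [set w | q * Y j w `^ beta > t * f x]
                 [set w | q * Y i w `^ beta > x] @[x --> +oo] --> (0 : R)) ->
  (forall i j : 'I_d, (i < j)%N -> exists L : R, 0 < L /\
     prob P [set w | q * Y j w `^ beta > L * f x /\
                     q * Y i w `^ beta > L * f x]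
     / prob P [set w | q * Y i w `^ beta > x] @[x --> +oo] --> (0 : R)) ->
  asymp_equiv
    (fun x => prob P [set w | \sum_(i < d) a i * Y i w `^ b i > x])
    (fun x => J%:R * prob P [set w | Y1 w `^ beta > x / q]).
Proof.
move=> beta q J Y1 F Finfty _ [f_aux f'0 f_sn F_tail] f_cvgy joint_small joint_large.
have q_ge0 : 0 <= q by exact: bigmax_ge_id.
have q0 := infinite_right_endpoint_scaled_power q_ge0 Finfty.
pose X i w := q * Y i w `^ beta; pose Z i w := a i * Y i w `^ b i.
pose D i := (b i == beta) && (a i == q); pose G := survival F.
have X_tail i x : prob P [set w | x < X i w] = G x.
  rewrite /G survival_real_cdf; exact: identically_distributed_scaled_power.
have G_gt0 x : 0 < G x.
  by rewrite /G survival_real_cdf; exact: infinite_right_endpoint_prob_gt0.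
have JD : J = #|D| by rewrite /J /num_dominant cardsE.
have f_sublinear : forall e, 0 < e -> \forall x \near +oo, f x <= e * x.
  by apply: derive1_cvg0_sublinear => //; apply: filterS f_aux => x [].
have H : prob P [set w | x < \sum_i Z i w] / G x @[x --> +oo] --> (#|D|%:R : R).
  apply: (@sum_tail_equiv _ _ _ P d d_ge1 X Z D G f) => //.
  - by move=> i; exact: (measurable_scaled_power q beta (Y i)).
  - by move=> i; exact: (measurable_scaled_power (a i) (b i) (Y i)).
  - by move=> i w; rewrite mulr_ge0 ?powR_ge0.
  - by move=> i /andP[/eqP bi /eqP ai]; rewrite /Z /X bi ai.
  - move=> i nD; have [c [M [c0 c1 HM]]] := nondominant_le a_ge0 b_ge0 q0 nD.
    by exists c, M; split => // w; exact: HM.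
  - by move=> i w; rewrite mulr_ge0 ?powR_ge0.
  - move=> i j ij t t0; under eq_cvg do rewrite -(X_tail i).
    exact: joint_small.
  - move=> i j; rewrite neq_lt => /orP[ij|ji].
      have [L [L0 HL]] := joint_large _ _ ij; exists L; split=> //.
      by under eq_cvg do rewrite -(X_tail i).
    (* Assumption (ii) covers ordered pairs only; the joint event is symmetric and all [X i] share
       the tail [G], so the reversed pair follows. *)
    have [L [L0 HL]] := joint_large _ _ ji; exists L; split=> //.
    have swap x : [set w | L * f x < X j w /\ L * f x < X i w] =
        [set w | L * f x < X i w /\ L * f x < X j w].
      by apply/seteqP; split=> w [].
    by under eq_cvg do rewrite swap -(X_tail j).
(* Both maxima are attained, so a dominant index exists and the limit can be divided by [J]. *)
have J0 : J%:R != 0 :> R by rewrite pnatr_eq0 -lt0n num_dominant_gt0.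
have qY1 x : prob P [set w | x / q < Y1 w `^ beta] = G x.
  rewrite -(X_tail (Ordinal d_ge1)); congr (prob P _).
  by apply/seteqP; split=> w /=; rewrite ltr_pdivrMr// mulrC.
have : prob P [set w | x < \sum_i Z i w] / G x / J%:R @[x --> +oo]
    --> (J%:R / J%:R : R).
  by apply: cvgM; [rewrite JD; exact: H|exact: cvg_cst].
rewrite mulfV// => HJ.
rewrite /asymp_equiv.
rewrite (_ : (fun x => _) =
    (fun x => prob P [set w | x < \sum_i Z i w] / G x / J%:R))//.
by apply/funext => x /=; rewrite qY1 invfM mulrA mulrAC.
Qed.
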